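(* Let $X$ be a proper geodesic metric space with basepoint $\mathfrak{o}$, and let $\gamma$ be a geodesic ray in $X$ starting at $\mathfrak{o}$. Then $\gamma$ is sublinearly Morse if and only if $\gamma$ is middle third recurrent.
   Context: Write $\|x\|=d(\mathfrak{o},x)$. A sublinear function is a monotone increasing concave function $\kappa:[0,\infty)\to[1,\infty)$ with $\kappa(t)/t\to0$ as $t\to\infty$. For $Z\subseteq X$ closed and $n\ge0$, $\mathcal N_\kappa(Z,n)=\{x\in X:d(x,Z)\le n\,\kappa(\|x\|)\}$. A $(q,Q)$-quasi-geodesic segment ($q\ge1,Q\ge0$) is a continuous map $\beta:[s,t]\to X$ with $\frac1q|u-v|-Q\le d(\beta(u),\beta(v))\le q|u-v|+Q$. A closed set $Z$ is $\kappa$-Morse if there is a function $m_Z:\mathbb R_+^2\to\mathbb R_+$ such that every $(q,Q)$-quasi-geodesic segment with endpoints on $Z$ is contained in $\mathcal N_\kappa(Z,m_Z(q,Q))$; $Z$ is sublinearly Morse if it is $\kappa$-Morse for some sublinear function $\kappa$. All paths are embeddings of compact intervals (self-avoiding), and $\ell(p)$ is the arc length of a path $p$. For $a,b\in\gamma$, $\gamma[a,b]$ is the part of $\gamma$ between $a$ and $b$, and its middle third is $\gamma_{\frac13[a,b]}=\{x\in\gamma[a,b]:\min\{d(x,a),d(x,b)\}\ge\frac13 d(a,b)\}$. The ray $\gamma$ is middle third recurrent if there is a sublinear function $\kappa$ such that for every $C\ge1$ there is a constant $c$ (depending on $C$ and $\gamma$) such that every path $p$ with endpoints $a,b\in\gamma$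 and $\ell(p)\le C\,d(a,b)$ satisfies $p\cap\mathcal N_\kappa(\gamma_{\frac13[a,b]},c)\ne\emptyset$. *)

(* Defs.v *)
From HB Require Import structures.
From mathcomp Require Import all_boot all_order all_algebra.
From mathcomp Require Import all_classical all_reals all_analysis.

Set Implicit Arguments.
Unset Strict Implicit.
Unset Printing Implicit Defensive.

Import Order.TTheory GRing.Theory Num.Theory.
Import numFieldNormedType.Exports.

Local Open Scope classical_set_scope.
Local Open Scope ring_scope.

Definition embedding_on (T U : topologicalType) (A : set T) (f : T -> U) :=
  exists g : U -> T,
    [/\ {within A, continuous f}, {within f @` A, continuous g}
      & {in A, cancel f g}].

Section MetricSpace.
Context {R : realType} {X : metricType R}.
Implicit Types (x y a b o : X) (Z : set X).

Definition proper_space :=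
  forall x (r : R), compact [set y | mdist x y <= r].

Definition isometric_on (I : set R) (g : R -> X) :=
  {in I &, forall u v, mdist (g u) (g v) = `|u - v|}.

Definition geodesic_space :=
  forall x y, exists g : R -> X,
    [/\ isometric_on `[0, mdist x y] g, g 0 = x & g (mdist x y) = y].

(* Maps defined on an interval are represented by total functions on R, whose
   values outside the interval are irrelevant. *)
Definition geodesic_ray (gamma : R -> X) := isometric_on `[0, +oo[ gamma.

Definition ray_set (gamma : R -> X) : set X := gamma @` `[0, +oo[.

(* Extended real valued: the distance to the empty set is +oo. *)
Definition set_dist x Z : \bar R := ereal_inf [set (mdist x z)%:E | z in Z].

(* "Increasing" is not strict, so that constant functions are allowed. *)
Definition sublinear_function (kappa : R -> R) :=
  [/\ {in `[0, +oo[, forall t, 1 <= kappa t},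
      {in `[0, +oo[ &, {homo kappa : s t / s <= t}},
      convex_function (`[0, +oo[%classic : set R) (fun t : R => - kappa t)
    & kappa t / t @[t --> +oo] --> (0 : R)].

Definition kappa_nbhd o (kappa : R -> R) Z (n : R) : set X :=
  [set x | (set_dist x Z <= (n * kappa (mdist o x))%:E)%E].

Definition quasi_geodesic (q Q s t : R) (beta : R -> X) :=
  {within `[s, t], continuous beta} /\
  {in `[s, t] &, forall u v,
    q^-1 * `|u - v| - Q <= mdist (beta u) (beta v) <= q * `|u - v| + Q}.

Definition kappa_Morse o (kappa : R -> R) Z :=
  closed Z /\
  exists m : R -> R -> R,
    (forall q Q : R, 0 <= q -> 0 <= Q -> 0 <= m q Q) /\
    forall (q Q s t : R) (beta : R -> X),
      1 <= q -> 0 <= Q -> s <= t -> quasi_geodesic q Q s t beta ->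
      Z (beta s) -> Z (beta t) ->
      beta @` `[s, t] `<=` kappa_nbhd o kappa Z (m q Q).

Definition sublinearly_Morse o Z :=
  exists2 kappa, sublinear_function kappa & kappa_Morse o kappa Z.

(* Length of the polygon inscribed in p with vertices at s :: l; compare
   [variation] for real-valued functions. *)
Definition polygon_length (s t : R) (p : R -> X) (l : seq R) : R :=
  let P := p \o nth t (s :: l) in
  \sum_(0 <= n < size l) mdist (P n) (P n.+1).

Definition arc_length (s t : R) (p : R -> X) : \bar R :=
  ereal_sup [set (polygon_length s t p l)%:E | l in itv_partition s t].

(* gamma[a, b]; for a geodesic ray, u and v are determined by a and b. *)
Definition ray_between (gamma : R -> X) a b : set X :=
  [set x | exists u v w,
    [/\ 0 <= u, 0 <= v, gamma u = a & gamma v = b] /\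
    (Num.min u v <= w <= Num.max u v /\ gamma w = x)].

Definition middle_third (gamma : R -> X) a b : set X :=
  [set x | ray_between gamma a b x /\
    3^-1 * mdist a b <= Num.min (mdist x a) (mdist x b)].

Definition middle_third_recurrent o (gamma : R -> X) :=
  exists2 kappa, sublinear_function kappa &
    forall C : R, 1 <= C -> exists2 c : R, 0 <= c &
      forall (s t : R) (p : R -> X),
        s <= t -> @embedding_on R X `[s, t] p ->
        ray_set gamma (p s) -> ray_set gamma (p t) ->
        (arc_length s t p <= (C * mdist (p s) (p t))%:E)%E ->
        p @` `[s, t] `&`
          kappa_nbhd o kappa (middle_third gamma (p s) (p t)) c !=set0.

End MetricSpace.

Arguments proper_space {R} X.
Arguments geodesic_space {R} X.

(* Main.v *)
(* For a Morse ray, give the points near the middle third a large weight W and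
   minimise the weighted length over chains from a to b. The minimiser is a
   quasi-geodesic whose constants depend on W only, so it stays sublinearly
   close to the ray, crosses the middle third and pays W for it; since a path of
   length at most C d(a, b) avoiding the middle third would be cheaper, such a
   path exists only if d(a, b) is itself sublinear.

   Conversely, cut a quasi-geodesic at the last and first times u <= v around r
   at which it is close to the ray and join it to the ray at both ends. After
   erasing loops this is an arc of length at most C d(a, b), so it meets a
   neighbourhood of the middle third; it can do so only near its ends, which
   bounds d(a, b), hence v - u, by a multiple of kappa. *)

Require Import Defs.
From mathcomp Require Import all_boot all_order all_algebra.
From mathcomp Require Import all_classical all_reals all_analysis.
From mathcomp Require Import ring lra zify.

Set Implicit Arguments.
Unset Strict Implicit.
Unset Printing Implicit Defensive.

Import Order.TTheory GRing.Theory Num.Theory.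
Import numFieldNormedType.Exports.

Local Open Scope classical_set_scope.
Local Open Scope ring_scope.

(** * Distances to sets and estimates for sublinear functions *)

Lemma set_dist_le (R : realType) (X : metricType R) (x z : X) (Z : set X)
    (r : R) : Z z -> mdist x z <= r -> (set_dist x Z <= r%:E)%E.
Proof.
move=> Zz xzr; apply: (@le_trans _ _ (mdist x z)%:E); last by rewrite lee_fin.
by apply: ereal_inf_lbound; exists z.
Qed.

(** The infimum need not be attained, so a point of [Z] costs a strictly larger bound; hence the
    constants [m W%:R 5 + 1] and [c + 1] below. *)
Lemma set_dist_ltP (R : realType) (X : metricType R) (x : X) (Z : set X)
    (r s : R) : (set_dist x Z <= r%:E)%E -> r < s ->
  exists2 z, Z z & mdist x z < s.
Proof.
move=> xZr rs.
have /ereal_inf_lt[_ [z Zz <-]] : (set_dist x Z < s%:E)%E.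
  by apply: le_lt_trans xZr _; rewrite lte_fin.
by rewrite lte_fin => xzs; exists z.
Qed.

Section Sublinear.
Context {R : realType} {kappa : R -> R}.
Hypothesis kappaS : sublinear_function kappa.
Implicit Types s t M : R.

Lemma sublin_ge1 t : 0 <= t -> 1 <= kappa t.
Proof. by case: kappaS => k1 _ _ _ t0; apply: k1; rewrite in_itv/= t0. Qed.

Lemma sublin_homo s t : 0 <= s -> s <= t -> kappa s <= kappa t.
Proof.
case: kappaS => _ kh _ _ s0 st; apply: kh; rewrite ?in_itv/= ?andbT//.
exact: le_trans st.
Qed.

(** Concavity between 0 and [t], with the term in [kappa 0] dropped as nonnegative: [kappa t / t] is
    nonincreasing, written without division to include 0. *)
Lemma sublin_concave0 s t : 0 <= s -> s <= t -> s * kappa t <= t * kappa s.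
Proof.
case: kappaS => _ _ kc _ s0 st.
have [t0|t0] := leP t 0.
  have -> : t = 0 by apply/le_anti; rewrite t0 (le_trans s0).
  by have -> : s = 0 by apply/le_anti; rewrite s0 (le_trans st).
have l0 : 0 <= s / t by rewrite divr_ge0// ltW.
have l1 : s / t <= 1 by rewrite ler_pdivrMr// mul1r.
have := kc (Itv01 l0 l1) t 0.
rewrite !inE/= !in_itv/= (ltW t0) lexx => /(_ isT isT).
have cE : conv (Itv01 l0 l1) (t : convex_lmodType R^o) 0 = s.
  rewrite /conv /= scaler0 addr0.
  by rewrite -[LHS]/(s / t * t) divfK// gt_eqF.
rewrite cE convRE /= /unstable.onem => h.
have k0 := sublin_ge1 (lexx 0).
have {}h : s / t * kappa t <= kappa s by nra.
by rewrite -ler_pdivrMl// mulrA [t^-1 * s]mulrC.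
Qed.

Lemma sublinD s t : 0 <= s -> 0 <= t -> kappa (s + t) <= kappa s + kappa t.
Proof.
move=> s0 t0.
have [st0|st0] := leP (s + t) 0.
  have -> : s = 0 by apply/le_anti/andP; lra.
  have -> : t = 0 by apply/le_anti/andP; lra.
  by have := sublin_ge1 (lexx 0); rewrite addr0 => ?; lra.
have := @sublin_concave0 s (s + t) s0 ltac:(lra).
have := @sublin_concave0 t (s + t) t0 ltac:(lra) => ? ?.
by rewrite -(ler_pM2l st0); nra.
Qed.

Lemma sublinDM s t : 0 <= s -> 0 <= t ->
  kappa (s + t) <= (1 + kappa t) * kappa s.
Proof.
move=> s0 t0; apply: le_trans (sublinD s0 t0) _.
by have := sublin_ge1 s0; have := sublin_ge1 t0 => ? ?; nra.
Qed.

(** Past [T'] the ratio [kappa t / t] is below [1 / (2 (M + 1))]; before it, monotonicity gives the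
    constant [B]. The slope 1/2 lets [sublin_comparable] absorb an error term into [s]. *)
Lemma sublin_affine M : 0 <= M ->
  exists2 B, 0 <= B & forall t, 0 <= t -> M * kappa t <= t / 2 + B.
Proof.
move=> M0; have [_ _ _ kl] := kappaS.
have e0 : 0 < (2 * (M + 1))^-1 by rewrite invr_gt0; lra.
have [T [_ TP]] := cvgr_dist_lt _ _ kl _ e0.
pose T' := Num.max T 0 + 1.
have T'0 : 0 < T' by rewrite /T' ltr_wpDl// le_max lexx orbT.
have T'T : T < T' by rewrite /T' ltr_pwDr// le_max lexx.
exists (M * kappa T') => [|t t0].
  by rewrite mulr_ge0// (le_trans _ (sublin_ge1 (ltW T'0))).
have [tT|Tt] := leP t T'.
  rewrite (le_trans (ler_wpM2l M0 (sublin_homo t0 tT)))//.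
  by rewrite lerDr divr_ge0.
have kT : 0 <= M * kappa T'.
  by rewrite mulr_ge0// (le_trans _ (sublin_ge1 (ltW T'0))).
have := TP t (lt_trans T'T Tt).
rewrite sub0r normrN => /ltW /(le_trans (ler_norm _)).
have t0' : 0 < t by apply: lt_trans Tt.
rewrite ler_pdivrMr// => ktM.
have /(ler_wpM2l M0) := ktM; move/le_trans; apply.
apply: (@le_trans _ _ (t / 2)); last by rewrite lerDl.
have -> : M * ((2 * (M + 1))^-1 * t) = M / (M + 1) * (t / 2).
  by field; lra.
rewrite ler_piMl//; first by rewrite divr_ge0// ltW.
by rewrite ler_pdivrMr; lra.
Qed.

(** For [t < s] the error is at most [2 M kappa s <= s / 2 + B], so [s <= 2 t + 2 B] and
    subadditivity applies. This moves the weight [kappa] between points whose distance is itself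
    sublinear. *)
Lemma sublin_comparable M : 0 <= M -> exists2 M', 1 <= M' &
  forall s t, 0 <= s -> 0 <= t -> s <= t + M * (kappa s + kappa t) ->
    kappa s <= M' * kappa t.
Proof.
move=> M0; have [B B0 BP] := @sublin_affine (2 * M) ltac:(lra).
have kB := @sublin_ge1 (2 * B) ltac:(lra).
exists (2 + kappa (2 * B)) => [|s t s0 t0 sMt]; first lra.
have kt := sublin_ge1 t0.
have [st|ts] := leP s t.
  by have := sublin_homo s0 st => ?; nra.
have kst := sublin_homo t0 (ltW ts).
have hs := BP s s0.
have s2 : s <= (t + t) + 2 * B by nra.
have := sublin_homo s0 s2.
have := @sublinD (t + t) (2 * B) ltac:(lra) ltac:(lra).
have := sublinD t0 t0 => ? ? ?.
nra.
Qed.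

End Sublinear.

(** * Lipschitz paths and arcs *)

Section Lipschitz.
Context {R : realType} {X : metricType R}.
Implicit Types (f g p : R -> X) (x y z : X).

Definition lip1 f := forall s t, mdist (f s) (f t) <= `|s - t|.

Lemma lip1_continuous f : lip1 f -> continuous f.
Proof.
move=> fl t; apply/metricType_numDomainType.cvgrPdist_lt => e e0.
have /cvgrPdist_lt/(_ _ e0) : (s @[s --> t]) --> t by exact: cvg_id.
by apply: filterS => s ts; apply: le_lt_trans ts.
Qed.

Lemma lip1_glue f g (a : R) : lip1 f -> lip1 g -> f a = g a ->
  lip1 (fun t => if t <= a then f t else g t).
Proof.
move=> fl gl fga.
have mixed s t : s <= a -> a < t -> mdist (f s) (g t) <= `|s - t|.
  move=> sa at_; apply: le_trans (metric_triangle _ (f a) _) _.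
  have := fl s a; have := gl a t; rewrite -fga.
  rewrite !ler0_norm ?subr_le0// ?(ltW at_)// ?(le_trans sa (ltW at_))//.
  by move=> ? ?; lra.
move=> s t; have [sa|sa] := leP s a; have [ta|ta] := leP t a => //.
- exact: mixed.
- by rewrite metric_sym distrC; exact: mixed.
Qed.

Lemma continuous_compact_image f (a b : R) :
  continuous f -> compact (f @` `[a, b]).
Proof.
move=> fc; apply: continuous_compact; last exact: segment_compact.
exact: continuous_subspaceT.
Qed.

Lemma lip1_embedding (a b : R) p : lip1 p ->
  {in `[a, b] &, injective p} -> @embedding_on R X `[a, b] p.
Proof.
move=> pl pinj; have pc := lip1_continuous pl.
have exg y : exists t, (p @` `[a, b]) y -> t \in `[a, b] /\ p t = y.
  by have [[t tab <-]|?] := pselect ((p @` `[a, b]) y); [exists t|exists 0].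
have [g gP] := choice exg; exists g; split.
- exact: continuous_subspaceT.
- apply/subspace_continuousP => y /= py; apply/cvgrPdist_lt => e e0.
  have [gab pg] := gP _ py.
  (* The parameters far from [g y] have a compact, hence closed, image that misses [y] by
     injectivity; off that image [g] stays within [e] of [g y]. *)
  pose K := [set t | t \in `[a, b] /\ e <= `|g y - t|].
  have cK : compact (p @` K).
    apply: continuous_compact; first exact: continuous_subspaceT.
    rewrite (_ : K = `[a, b] `&` [set t | e <= `|g y - t|]); last first.
      by apply/seteqP; split.
    apply: compact_closedI; first exact: segment_compact.
    apply: (@closed_comp _ _ (fun t => `|g y - t|) [set r | e <= r]).
      move=> t _; apply: cvg_norm; apply: cvgB; [exact: cvg_cst|exact: cvg_id].
    exact: closed_ge.
  have nK : ~ (p @` K) y.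
    move=> [t [tab et] pty].
    have gyt : g y = t by apply: pinj => //; rewrite pg.
    by move: et; rewrite gyt subrr normr0 leNgt e0.
  have : open (~` (p @` K)).
    by apply: closed_openC; apply: compact_closed cK; exact: metric_hausdorff.
  rewrite openE => /(_ _ nK); apply: filterS => z /= nz pz.
  rewrite ltNge; apply/negP => ez; apply: nz.
  by have [gzab pgz] := gP _ pz; exists (g z).
- move=> t; rewrite inE/= => tab.
  have [gab pg] := gP (p t) (ex_intro2 _ _ t tab erefl).
  exact: pinj.
Qed.

Lemma polygon_length_nil (s t : R) p : polygon_length s t p [::] = 0.
Proof. by rewrite /polygon_length big_geq. Qed.

Lemma polygon_length_cons (s t r : R) p l :
  polygon_length s t p (r :: l) = mdist (p s) (p r) + polygon_length r t p l.
Proof. by rewrite /polygon_length big_nat_recl. Qed.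

Lemma polygon_length_rcons (s t r : R) p l :
  polygon_length s t p l <= polygon_length s t p (rcons l r).
Proof.
elim: l s => [|v l IH] s /=; last by rewrite !polygon_length_cons lerD2l.
by rewrite polygon_length_cons !polygon_length_nil addr0 mdist_ge0.
Qed.

Lemma lip1_polygon_length p (s t : R) l : lip1 p -> path <%O s l ->
  polygon_length s t p l <= last s l - s.
Proof.
move=> pl; elim: l s => [|r l IH] s /=.
  by rewrite polygon_length_nil subrr.
move=> /andP[sr /IH rl]; rewrite polygon_length_cons.
by have := pl s r; rewrite distrC ger0_norm ?subr_ge0 ?(ltW sr)// => ?; lra.
Qed.

Lemma lip1_arc_length p (s t : R) : lip1 p ->
  (arc_length s t p <= (t - s)%:E)%E.
Proof.
move=> pl; apply: ge_ereal_sup => _ [l [ls /eqP lt] <-].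
by rewrite lee_fin -[in leRHS]lt; exact: lip1_polygon_length.
Qed.

Hypothesis Xgeodesic : geodesic_space X.

(** A geodesic precomposed with the clamp of R onto [[0, d]] is 1-Lipschitz on all of R, so pieces
    can be glued without tracking domains. *)
Lemma segment_lip1 x y : exists g, [/\ lip1 g, g 0 = x,
  forall t, mdist x y <= t -> g t = y,
  {in `[0, mdist x y] &, forall s t, mdist (g s) (g t) = `|s - t|} &
  forall t, mdist x (g t) + mdist (g t) y = mdist x y].
Proof.
have [h [hi h0 hd]] := Xgeodesic x y; set d := mdist x y in hi hd *.
have d0 : 0 <= d by exact: mdist_ge0.
have {}hi : {in `[0, d] &, forall s t, mdist (h s) (h t) = `|s - t|}.
  by move=> s t sI tI; apply: hi; rewrite inE.
have [c [cI cid cd cl]] : exists c : R -> R, [/\ forall t, c t \in `[0, d],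
    forall t, t \in `[0, d] -> c t = t, forall t, d <= t -> c t = d
    & forall s t, `|c s - c t| <= `|s - t|].
  exists (fun t => Num.max 0 (Num.min t d)); split.
  - by move=> t; rewrite in_itv/= le_max lexx/= ge_max d0 ge_min lexx orbT.
  - move=> t; rewrite in_itv/= => /andP[t0 td].
    by rewrite (min_idPl td) (max_idPr t0).
  - by move=> t dt; rewrite (min_idPr dt) (max_idPr d0).
  - move=> s t; have := ler_norm (s - t); have := ler_norm (t - s).
    rewrite (distrC t) => ? ?; rewrite ler_norml.
    case: (leP s d) => sd; case: (leP t d) => td; rewrite ?(max_idPr d0);
    case: (leP 0 s) => ?; case: (leP 0 t) => ?; lra.
have c0 : 0 \in `[0, d] by rewrite in_itv/= lexx.
have dd : d \in `[0, d] by rewrite in_itv/= lexx andbT.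
exists (h \o c); split.
- by move=> s t; rewrite /comp hi//; exact: cl.
- by rewrite /comp cid.
- by move=> t dt; rewrite /comp cd.
- by move=> s t sI tI; rewrite /comp hi// !cid.
- move=> t; rewrite /comp.
  have -> : mdist x (h (c t)) = `|0 - c t| by rewrite -{1}h0 hi.
  have -> : mdist (h (c t)) y = `|c t - d| by rewrite -[in LHS]hd hi.
  have := cI t; rewrite in_itv/= => /andP[ct0 ctd].
  by rewrite sub0r normrN ger0_norm// ler0_norm; lra.
Qed.

(** A step of length at most 1 fits in unit time: its geodesic runs at unit speed and then waits at
    the endpoint. *)
Lemma lip1_interpolation (x : nat -> X) n :
  (forall i, (i < n)%N -> mdist (x i) (x i.+1) <= 1) ->
  exists2 f, lip1 f & forall i, (i <= n)%N -> f i%:R = x i.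
Proof.
elim: n => [|n IH] xn.
  exists (cst (x 0%N)) => [s t|i]; first by rewrite /= mdistxx.
  by rewrite leqn0 => /eqP ->.
have [i ni|f fl fx] := IH; first by apply: xn; rewrite ltnW.
have [g [gl g0 g1 _ _]] := segment_lip1 (x n) (x n.+1).
exists (fun t => if t <= n%:R then f t else g (t - n%:R)).
  apply: lip1_glue => //; last by rewrite subrr g0 fx.
  by move=> s t; apply: le_trans (gl _ _) _; rewrite opprB addrA subrK.
move=> i; rewrite leq_eqVlt ler_nat => /orP[/eqP ->|]; last first.
  by rewrite ltnS => ni; rewrite ni fx.
by rewrite ltnn g1// -natr1 addrAC subrr add0r; exact: xn.
Qed.

(* Loops are erased one geodesic piece at a time: the new piece is entered at
   its last intersection with the arc built so far. *)
Lemma chain_arc (y : nat -> X) n : exists (l : R) p,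
  [/\ 0 <= l, lip1 p, {in `[0, l] &, injective p}, p 0 = y 0%N & p l = y n] /\
  l <= \sum_(0 <= i < n) mdist (y i) (y i.+1) /\
  forall t, t \in `[0, l] -> p t = y 0%N \/ exists2 i, (i < n)%N &
    mdist (y i) (p t) + mdist (p t) (y i.+1) = mdist (y i) (y i.+1).
Proof.
elim: n => [|n [l [p [[l0 pl pinj p0 pe] [lle pP]]]]].
  exists 0, (cst (y 0%N)); split; [split => //|split].
  - by move=> s t; rewrite /= mdistxx.
  - by move=> s t; rewrite !in_itv/= => /le_anti <- /le_anti <-.
  - by rewrite big_geq.
  - by move=> t _; left.
have [g [gl g0 g1 gi gb]] := segment_lip1 (y n) (y n.+1).
set d := mdist (y n) (y n.+1) in g1 gi gb.
have d0 : 0 <= d by exact: mdist_ge0.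
pose T := `[0, d]%classic `&` g @^-1` (p @` `[0, l]).
have T0 : T !=set0.
  exists 0; split; first by rewrite /= in_itv/= lexx.
  by exists l; rewrite ?g0// /= in_itv/= l0 lexx.
have cT : compact T.
  apply: compact_closedI; first exact: segment_compact.
  apply: closed_comp; first by move=> t _; exact: lip1_continuous.
  apply: compact_closed; first exact: metric_hausdorff.
  by apply: continuous_compact_image; exact: lip1_continuous.
have idc : {within T, continuous (@id R)}.
  by apply: continuous_subspaceT => t; exact: cvg_id.
have [a /set_mem[/= ad [b bl pb]] amax] := compact_EVT_max T0 cT idc.
have {}amax t : a < t -> t <= d -> ~ (p @` `[0, l]) (g t).
  move=> at_ td pgt; move: ad; rewrite in_itv/= => /andP[a0 _].
  have /amax : t \in T.
    by apply/mem_set; split => //=; rewrite in_itv/= td andbT; lra.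
  by rewrite leNgt at_.
move: ad; rewrite in_itv/= => /andP[a0 ad].
move: bl; rewrite in_itv/= => /andP[b0 bl].
pose q t := if t <= b then p t else g (t - b + a).
exists (b + d - a), q; split; [split|split].
- lra.
- apply: lip1_glue => //; last by rewrite subrr add0r.
  move=> s t; apply: le_trans (gl _ _) _; rewrite le_eqVlt; apply/orP; left.
  by apply/eqP; congr `|_|; ring.
- have mixed s t : 0 <= s -> s <= b -> b < t -> t <= b + d - a ->
      p s = g (t - b + a) -> s = t.
    move=> s0 sb bt td pg; exfalso; apply: (amax (t - b + a)); [lra|lra|].
    by exists s => //=; rewrite in_itv/= s0/=; lra.
  move=> s t; rewrite !in_itv/= /q => /andP[s0 sl] /andP[t0 tl].
  have [sb|bs] := leP s b; have [tb|bt] := leP t b.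
  + by apply: pinj; rewrite in_itv/= ?s0 ?t0/=; lra.
  + exact: mixed.
  + by move=> /esym/mixed h; apply/esym/h.
  + move=> gst; have := gi (s - b + a) (t - b + a).
    rewrite gst mdistxx !in_itv/= => /(_ ltac:(lra) ltac:(lra))/esym/normr0_eq0.
    by move=> ?; lra.
- by rewrite /q b0.
- rewrite /q; case: leP => h; last by apply: g1; lra.
  have -> : b + d - a = b by lra.
  by rewrite pb; apply: g1; lra.
- by rewrite big_nat_recr//=; rewrite -/d; lra.
- move=> t; rewrite in_itv/= /q => /andP[t0 tl].
  have [tb|bt] := leP t b; last by right; exists n.
  have [|->|[i ni ie]] := pP t; first by rewrite in_itv/= t0; lra.
    by left.
  by right; exists i => //; rewrite ltnW.
Qed.

End Lipschitz.

(** * Chains of minimal weighted cost *)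

Section WeightedChains.
Context {R : realType} {X : metricType R}.
Hypothesis Xgeodesic : geodesic_space X.
Implicit Types (x y z : X).

Lemma geodesic_step x y k : mdist x y <= k.+1%:R ->
  exists2 z, mdist x z <= 1 & mdist z y <= k%:R.
Proof.
move=> xyk; have [xy1|xy1] := leP (mdist x y) 1.
  by exists y => //; rewrite mdistxx.
have [g [_ g0 _ gi gb]] := segment_lip1 Xgeodesic x y.
have xg : mdist x (g 1) = 1.
  rewrite -g0 gi ?in_itv/= ?lexx ?ler01 ?mdist_ge0 ?(ltW xy1)//.
  by rewrite sub0r normrN normr1.
exists (g 1); first by rewrite xg.
by have := gb 1; rewrite xg -natr1 in xyk * => ?; lra.
Qed.

Variables (w : X -> nat) (W : nat) (b : X).
Hypotheses (w_gt0 : forall x, (0 < w x)%N) (w_le : forall x, (w x <= W)%N).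

(** A vertex is paid for when it is left, so arriving at [b] is free. Weights are natural numbers,
    so that a least cost exists by well-ordering. *)
Inductive chain_cost : X -> nat -> Prop :=
| ChainCost0 : chain_cost b 0
| ChainCostS x y c : mdist x y <= 1 -> chain_cost y c ->
    chain_cost x (w x + c).

Lemma chain_cost_dist k x : mdist x b <= k%:R -> exists c, chain_cost x c.
Proof.
elim: k x => [|k IH] x xb.
  have -> : x = b.
    by apply: mdist_positivity; apply/le_anti; rewrite xb mdist_ge0.
  by exists 0%N; constructor.
have [z xz /IH[c cz]] := geodesic_step xb.
by exists (w x + c)%N; apply: ChainCostS cz.
Qed.

Lemma chain_cost_inv x n : chain_cost x n -> x = b \/
  exists y c, [/\ mdist x y <= 1, chain_cost y c & n = (w x + c)%N].
Proof. by case=> [|x' y c]; [left|right; exists y, c]. Qed.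

(** [D] is the least cost of reaching [b]. The clauses are its dynamic programming relations: some
    unit step attains the minimum, and descending along such steps gives an optimal chain. *)
Lemma cost_potential : exists D : X -> nat,
  [/\ D b = 0%N, forall x y, mdist x y <= 1 -> (D x <= w x + D y)%N &
    forall x, x <> b -> exists2 y, mdist x y <= 1 & D x = (w x + D y)%N].
Proof.
have /choice[D DP] x : exists n, chain_cost x n /\
    forall c, chain_cost x c -> (n <= c)%N.
  have [c xc] : exists c, chain_cost x c.
    apply: (@chain_cost_dist (Num.truncn (mdist x b)).+1).
    by have /andP[_ /ltW] := truncn_itv (mdist_ge0 x b).
  have exc : exists c, `[< chain_cost x c >] by exists c; apply/asboolP.
  case: (ex_minnP exc) => n /asboolP xn nmin; exists n; split => // c'.
  by move=> /asboolP; exact: nmin.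
exists D; split.
- by apply/eqP; rewrite -leqn0; apply: (DP b).2; constructor.
- by move=> x y xy; apply: (DP x).2; apply: ChainCostS xy (DP y).1.
- move=> x xb; have [xD Dmin] := DP x.
  have [//|[y [c [xy cy Dx]]]] := chain_cost_inv xD.
  exists y => //; rewrite Dx.
  apply/eqP; rewrite eqn_add2l eqn_leq (DP y).2// andbT.
  rewrite -(leq_add2l (w x)) -Dx; apply: Dmin.
  exact: ChainCostS xy (DP y).1.
Qed.

(** An optimal chain [x] pays at least 1 per step, while unit steps along a geodesic would cost at
    most [W] each; comparing the two gives the multiplicative constant [W]. A run of vertices of
    weight [W] is paid out of a total of at most [N], the cost of [y]. *)
Lemma cheap_quasi_geodesic (y : nat -> X) (N : nat) : y N = b ->
  (forall i, (i < N)%N -> mdist (y i) (y i.+1) <= 1) ->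
  (forall i, (i <= N)%N -> w (y i) = 1%N) ->
  exists n (x : nat -> X) (f : R -> X),
    [/\ x 0%N = y 0%N, x n = b, forall i, (i <= n)%N -> f i%:R = x i &
      lip1 f] /\
    quasi_geodesic W%:R 5 0 n%:R f /\
    forall i j, (i < j <= n)%N ->
      (forall r, (i < r < j)%N -> w (x r) = W) -> (W * (j - i.+1) <= N)%N.
Proof.
move=> yN ystep yw; have [D [Db Dstep Dnext]] := cost_potential.
have W_gt0 : (0 < W)%N := leq_trans (w_gt0 b) (w_le b).
have Ddist k x z : mdist x z <= k%:R -> (D x <= W * k + D z)%N.
  elim: k x => [|k IH] x xz.
    have -> : x = z.
      by apply: mdist_positivity; apply/le_anti; rewrite xz mdist_ge0.
    by rewrite muln0.
  have [v xv vz] := geodesic_step xz.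
  have := Dstep _ _ xv; have := IH _ vz; have := w_le x; lia.
have Dy : (D (y 0%N) <= N)%N.
  have h k : (k <= N)%N -> (D (y (N - k)%N) <= k)%N.
    elim: k => [|k IH] kN; first by rewrite subn0 yN Db.
    have := IH (ltnW kN); have := ystep (N - k.+1)%N ltac:(lia).
    have -> : (N - k.+1).+1 = (N - k)%N by lia.
    by move=> /Dstep; rewrite yw; [lia|lia].
  by have := h N (leqnn N); rewrite subnn.
have [n [x [x0 xn xstep xD]]] : exists n (x : nat -> X), [/\ x 0%N = y 0%N,
    x n = b, forall i, (i < n)%N -> mdist (x i) (x i.+1) <= 1 &
    forall i, (i < n)%N -> D (x i) = (w (x i) + D (x i.+1))%N].
  have [m] := ubnP (D (y 0%N)); move: (y 0%N) => a.
  elim: m a => // m IH a aD.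
  have [->|/Dnext[z az aDz]] := pselect (a = b); first by exists 0%N, (fun=> b).
  have [|n [x [x0 xn xs xD]]] := IH z; first by have := w_gt0 a; lia.
  exists n.+1, (fun i => if i is j.+1 then x j else a); split => //.
  - by case=> [|i]//=; [rewrite x0|rewrite ltnS; exact: xs].
  - by case=> [|i]//=; [rewrite x0|rewrite ltnS; exact: xD].
have xDge i j : (i <= j)%N -> (j <= n)%N -> (j - i + D (x j) <= D (x i))%N.
  move=> ij; rewrite -(subnKC ij); elim: (j - i)%N => [|k IH] kn.
    by rewrite addn0 subnn.
  have := IH ltac:(lia); have := xD (i + k)%N ltac:(lia).
  by have := w_gt0 (x (i + k)%N); rewrite addnS; lia.
have [f fl fx] := lip1_interpolation Xgeodesic xstep.
exists n, x, f; split; [by split|split].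
- have lower i j : (i <= n)%N -> (j <= n)%N ->
      `|i%:R - j%:R| <= W%:R * (mdist (x i) (x j) + 1).
    wlog ij : i j / (i <= j)%N.
      move=> H iN jN; have [ij|/ltnW ji] := leqP i j; first exact: H.
      by rewrite distrC metric_sym; exact: H.
    move=> iN jN; rewrite distrC -natrB// normr_nat.
    have /andP[h1 /ltW h2] := truncn_itv (mdist_ge0 (x i) (x j)).
    have := Ddist _ _ _ h2; have := xDge _ _ ij jN => h3 h4.
    have : (j - i <= W * (Num.truncn (mdist (x i) (x j))).+1)%N by lia.
    rewrite -(ler_nat R) natrM => /le_trans; apply.
    by rewrite ler_wpM2l// -natr1 lerD2r.
  have near_vertex (u : R) : u \in `[0, n%:R] -> exists2 i, (i <= n)%N &
      `|u - i%:R| <= 1.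
    rewrite in_itv/= => /andP[u0 un]; have /andP[h1 h2] := truncn_itv u0.
    exists (Num.truncn u).
      by rewrite -(ler_nat R); apply: le_trans un.
    by rewrite ger0_norm; move: h2; rewrite -natr1; lra.
  have W1 : (1 : R) <= W%:R by rewrite ler1n.
  split=> [|u v uI vI].
    by apply: continuous_subspaceT; exact: lip1_continuous.
  have fuv := fl u v.
  apply/andP; split; last first.
    by apply: (le_trans fuv); have := normr_ge0 (u - v); nra.
  have [i iN ui] := near_vertex u uI; have [j jN vj] := near_vertex v vI.
  have ij := lower _ _ iN jN.
  have dui := fl u i%:R; have dvj := fl v j%:R; rewrite !fx// in dui dvj.
  have d1 : mdist (x i) (x j) <= mdist (f u) (f v) + 2.
    have := metric_triangle (x i) (f u) (x j).
    have := metric_triangle (f u) (f v) (x j).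
    by have := metric_sym (x i) (f u) => ? ? ?; lra.
  (* The 5 is spent as 1 for rounding the distance up, 2 for moving both ends to vertices, and 2 for
     the same shift of the parameters. *)
  rewrite lerBlDr ler_pdivrMl; last by lra.
  have : `|u - v| <= `|u - i%:R| + `|i%:R - j%:R| + `|v - j%:R|.
    have := ler_distD i%:R u v; have := ler_distD j%:R i%:R v.
    by rewrite (distrC v) => ? ?; lra.
  move=> tri; have : W%:R * (mdist (x i) (x j) + 1) <=
      W%:R * (mdist (f u) (f v) + 3) by rewrite ler_wpM2l//; lra.
  by move=> ?; nra.
- move=> i j /andP[ij jn] wW.
  have h k : (i.+1 + k <= j)%N ->
      (W * k + D (x (i.+1 + k)%N) <= D (x i.+1))%N.
    elim: k => [|k IH] kj; first by rewrite muln0 addn0.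
    have := IH ltac:(lia); have := xD (i.+1 + k)%N ltac:(lia).
    by rewrite wW ?addnS; lia.
  have := h (j - i.+1)%N; rewrite subnKC// leqnn => /(_ isT).
  by have := xDge 0%N i.+1 isT ltac:(lia); rewrite x0; lia.
Qed.

End WeightedChains.

(** Take [j] as the first index past [hi] and [i] as the last one before [j] that is below [lo]. The
    bound on [tau j.-1] is recorded because [tau j] may lie far beyond [hi]. *)
Lemma crossing_indices (R : realDomainType) (tau : nat -> R) (lo hi : R) n :
  tau 0%N < lo -> lo <= hi -> hi < tau n ->
  exists i j, [/\ (i < j <= n)%N, tau i < lo, hi < tau j, tau j.-1 <= hi &
    forall r, (i < r < j)%N -> lo <= tau r <= hi].
Proof.
move=> t0 lohi tn.
have exj : exists j, hi < tau j by exists n.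
case: (ex_minnP exj) => j tj jmin.
have j0 : (0 < j)%N.
  by case: j tj {jmin} => // h; move: (lt_le_trans t0 lohi); rewrite ltNge ltW.
have below r : (r < j)%N -> tau r <= hi.
  by move=> rj; rewrite leNgt; apply/negP => /jmin; rewrite leqNgt rj.
have exi : exists i, (i < j)%N && (tau i < lo) by exists 0%N; rewrite j0.
have bi i : (i < j)%N && (tau i < lo) -> (i <= j)%N by case/andP=> /ltnW.
case: (ex_maxnP exi bi) => i /andP[ij ti] imax.
exists i, j; split=> //; [by rewrite ij jmin|by apply: below; lia|].
move=> r /andP[ir rj]; rewrite (below _ rj) andbT leNgt.
by apply/negP => tr; have := imax r; rewrite rj tr => /(_ isT); lia.
Qed.

(** * Morse rays are recurrent *)

Section Ray.
Context {R : realType} {X : metricType R}.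
Implicit Types (x y : X) (gamma p : R -> X).

(** From the current point, the intermediate value theorem gives a later time at distance exactly 1,
    unless the end is within 1. These points span an inscribed polygon with unit edges, so at most
    [L] such steps occur. *)
Lemma coarse_chain (s t L : R) p : s <= t -> {within `[s, t], continuous p} ->
  (arc_length s t p <= L%:E)%E -> exists N (y : nat -> X),
  [/\ y 0%N = p s, y N = p t, forall i, (i < N)%N -> mdist (y i) (y i.+1) <= 1,
    forall i, (p @` `[s, t]) (y i) & N%:R <= L + 2].
Proof.
move=> st pc pL.
have L0 : 0 <= L.
  rewrite -lee_fin; apply: le_trans pL.
  have [->|st'] := eqVneq s t.
    apply: ereal_sup_ubound; exists [::] => //.
    by rewrite polygon_length_nil.
  apply: (@le_trans _ _ (polygon_length s t p [:: t])%:E); last first.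
    apply: ereal_sup_ubound; exists [:: t] => //.
    by split => //=; rewrite lt_neqAle st' st.
  by rewrite polygon_length_cons polygon_length_nil addr0 lee_fin mdist_ge0.
have step k s' : s <= s' -> s' <= t ->
    (exists N (y : nat -> X), [/\ y 0%N = p s', y N = p t,
      forall i, (i < N)%N -> mdist (y i) (y i.+1) <= 1,
      forall i, (p @` `[s, t]) (y i) & (N <= k.+1)%N]) \/
    exists l, [/\ path <%O s' l, last s' l <= t &
      k%:R <= polygon_length s' t p l].
  elim: k s' => [|k IH] s' ss' s't.
    by right; exists [::]; rewrite polygon_length_nil.
  have ps' : (p @` `[s, t]) (p s') by exists s'; rewrite //= in_itv/= ss'.
  have pt : (p @` `[s, t]) (p t) by exists t; rewrite //= in_itv/= st lexx.
  have [d1|d1] := leP (mdist (p s') (p t)) 1.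
    left; exists 1%N, (fun i => if i is 0%N then p s' else p t).
    by split => // -[|i].
  pose D (r : R) : R := mdist (p s') (p r).
  have dc : {within `[s', t], continuous D}.
    have sub : `[s', t]%classic `<=` `[s, t]%classic.
      by move=> r /=; rewrite !in_itv/= => /andP[? ->]; rewrite (le_trans ss').
    have := continuous_subspaceW sub pc.
    move=> /subspace_continuousP pc'; apply/subspace_continuousP => r /= rI.
    have FF : Filter (within `[s', t]%classic (nbhs (r : R))).
      exact: within_filter.
    apply/cvgrPdist_lt => e e0; rewrite /D.
    have near_r : within `[s', t]%classic (nbhs (r : R))
        [set v | mdist (p r) (p v) < e].
      have h := metricType_numDomainType.cvgr_dist_lt (pc' r rI) e0.
      exact: (h FF).
    apply: filterS near_r => v /=; apply: le_lt_trans.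
    have := metric_triangle (p s') (p r) (p v).
    have := metric_triangle (p s') (p v) (p r).
    rewrite (metric_sym (p v) (p r)) => ? ?.
    by rewrite /from_subspace ler_norml; apply/andP; split; lra.
  have [|r] := IVT s't dc (v := 1).
    by rewrite /D mdistxx ge_min ler01 le_max (ltW d1) orbT.
  rewrite in_itv/= /D => /andP[s'r rt] dr.
  have {}s'r : s' < r.
    rewrite lt_neqAle s'r andbT; apply/eqP => s'E.
    by move: dr; rewrite s'E mdistxx => /esym/eqP; rewrite oner_eq0.
  have [[N [y [y0 yN ys yp Nk]]]|[l [sl lt kl]]] :=
      IH r (le_trans ss' (ltW s'r)) rt.
    left; exists N.+1, (fun i => if i is j.+1 then y j else p s').
    split => //; last by case.
    by case=> [_|i]; [rewrite y0 dr|exact: ys].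
  right; exists (r :: l); split => //=; first by rewrite s'r.
  by rewrite polygon_length_cons dr -natr1; lra.
have /andP[h1 h2] := truncn_itv L0.
have [[N [y [y0 yN ys yp Nk]]]|[l [sl lt kl]]] :=
    step (Num.truncn L).+1 s (lexx s) st.
  exists N, y; split => //.
  by move: Nk; rewrite -(ler_nat R) -!natr1 => ?; lra.
have : ((polygon_length s t p l)%:E <= L%:E)%E.
  apply: le_trans pL.
  move: lt; rewrite le_eqVlt => /orP[lt|lt].
    by apply: ereal_sup_ubound; exists l.
  (* The polygon may stop before [t]; adding the vertex [t] makes it a partition and does not
     shorten it. *)
  apply: (@le_trans _ _ (polygon_length s t p (rcons l t))%:E); last first.
    apply: ereal_sup_ubound; exists (rcons l t) => //.
    by split; rewrite ?rcons_path ?sl ?last_rcons/=.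
  by rewrite lee_fin; exact: polygon_length_rcons.
by rewrite lee_fin => ?; lra.
Qed.

Lemma ray_dist gamma (u v : R) : geodesic_ray gamma -> 0 <= u -> 0 <= v ->
  mdist (gamma u) (gamma v) = `|u - v|.
Proof. by move=> gr u0 v0; apply: gr; rewrite inE/= in_itv/= ?u0 ?v0. Qed.

Lemma ray_norm gamma (u : R) : geodesic_ray gamma -> 0 <= u ->
  mdist (gamma 0) (gamma u) = u.
Proof. by move=> gr u0; rewrite ray_dist// sub0r normrN ger0_norm. Qed.

Lemma ray_middle_third gamma (u v r : R) : geodesic_ray gamma ->
  0 <= u -> u <= v -> u + (v - u) / 3 <= r <= v - (v - u) / 3 ->
  middle_third gamma (gamma u) (gamma v) (gamma r) /\
  middle_third gamma (gamma v) (gamma u) (gamma r).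
Proof.
move=> gr u0 uv /andP[ur rv]; have v0 : 0 <= v by lra.
have m1 : Num.min u v = u by apply/min_idPl.
have m2 : Num.max u v = v by apply/max_idPr.
have r0 : 0 <= r by lra.
have duv : mdist (gamma u) (gamma v) = v - u.
  by rewrite ray_dist// distrC ger0_norm// subr_ge0.
have dru : mdist (gamma r) (gamma u) = r - u.
  by rewrite ray_dist// ger0_norm; lra.
have drv : mdist (gamma r) (gamma v) = v - r.
  by rewrite ray_dist// distrC ger0_norm; lra.
split; split.
- exists u, v, r; split; [by split|]; rewrite m1 m2; split=> //.
  by apply/andP; split; lra.
- by rewrite duv dru drv le_min; apply/andP; split; lra.
- exists v, u, r; split; [by split|]; rewrite minC maxC m1 m2; split=> //.
  by apply/andP; split; lra.
- by rewrite metric_sym duv dru drv le_min; apply/andP; split; lra.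
Qed.

Hypothesis Xgeodesic : geodesic_space X.

(** If no vertex of [y] is close to the middle third, then [y] costs only [N], while the optimal
    chain has a run of at least [(v - u) / 3] heavy vertices, up to a multiple of [kappa v]. This
    forces [v - u <= F * kappa v], and then [gamma u] itself is close to the middle third, a
    contradiction. *)
Lemma Morse_coarse_middle gamma kappa (C : R) :
  geodesic_ray gamma -> sublinear_function kappa ->
  kappa_Morse (gamma 0) kappa (ray_set gamma) -> 1 <= C ->
  exists2 c : R, 0 <= c & forall (u v : R) N (y : nat -> X),
    0 <= u -> u <= v -> y 0%N = gamma u -> y N = gamma v ->
    (forall i, (i < N)%N -> mdist (y i) (y i.+1) <= 1) ->
    N%:R <= C * (v - u) + 2 ->
    exists i r, [/\ (i <= N)%N, u + (v - u) / 3 <= r <= v - (v - u) / 3 &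
      mdist (y i) (gamma r) <= c * kappa (mdist (gamma 0) (y i))].
Proof.
move=> gr kS [_ [m [m0 mP]]] C1.
(* With 12 the budget [C (v - u)] is at most [W (v - u) / 12], a quarter of the cost [W (v - u) / 3]
   of a crossing. *)
have [W W_gt0 WC] : exists2 W, (0 < W)%N & 12 * C <= W%:R.
  have C0 : 0 <= 12 * C by lra.
  exists (Num.truncn (12 * C)).+1 => //.
  by have /andP[_ /ltW] := truncn_itv C0.
pose M := m W%:R 5 + 1.
have M1 : 1 <= M by rewrite /M lerDr m0.
have [A A1 AP] := sublin_comparable kS (le_trans ler01 M1).
pose E := M * (2 * A + kappa 1).
have k1 : 1 <= kappa 1 by apply: sublin_ge1.
have E0 : 0 <= E by rewrite /E; nra.
pose F := 4 * (3 + E).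
have F0 : 0 <= F by rewrite /F; lra.
have [G G1 GP] := sublin_comparable kS F0.
(* [M] makes the shadowed vertices of the crossing good; [F * G] makes [y 0] good when [v - u] is
   sublinear. *)
exists (Num.max M (F * G)); first by rewrite le_max (le_trans ler01).
set c := Num.max M (F * G).
have cM : M <= c by rewrite /c le_max lexx.
have cF : F * G <= c by rewrite /c le_max lexx orbT.
move=> u v N y u0 uv yu yv ystep NC.
pose L := v - u; pose lo := u + L / 3; pose hi := v - L / 3.
have v0 : 0 <= v by lra.
have kv := sublin_ge1 kS v0; have ku := sublin_ge1 kS u0.
pose good x := exists2 r, lo <= r <= hi &
  mdist x (gamma r) <= c * kappa (mdist (gamma 0) x).
have [[i iN [r rI yr]]|nogood] := pselect (exists2 i, (i <= N)%N & good (y i)).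
  by exists i, r.
have {}uv : u < v.
  rewrite lt_neqAle uv andbT; apply/eqP => uvE; apply: nogood.
  exists 0%N => //; exists u.
    by rewrite /lo /hi /L uvE; apply/andP; split; lra.
  by rewrite yu mdistxx ray_norm//; nra.
pose w x := if `[< good x >] then W else 1%N.
have w_gt0 x : (0 < w x)%N by rewrite /w; case: ifP.
have w_le x : (w x <= W)%N by rewrite /w; case: ifP.
have yw i : (i <= N)%N -> w (y i) = 1%N.
  by move=> iN; rewrite /w asboolF// => gi; apply: nogood; exists i.
have [n [x [f [[x0 xn fx fl] [fq xW]]]]] :=
  cheap_quasi_geodesic Xgeodesic w_gt0 w_le yv ystep yw.
have n0 : n <> 0%N.
  move=> n0; have := ray_dist gr u0 v0; rewrite -yu -x0 -xn n0 mdistxx.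
  by rewrite ler0_norm; lra.
(* [tau i] is the parameter of a ray point near [x i], pinned to [u] and [v] at the ends; past [n]
   the value 0 is a default. *)
have /choice[tau tauP] i : exists r, [/\ 0 <= r, (i <= n)%N ->
    mdist (x i) (gamma r) <= M * kappa (mdist (gamma 0) (x i)),
    (i = 0%N -> r = u) & (i = n -> r = v)].
  have ki := sublin_ge1 kS (mdist_ge0 (gamma 0) (x i)).
  have Mk : 0 <= M * kappa (mdist (gamma 0) (x i)) by nra.
  have [i0|i0] := eqVneq i 0%N.
    exists u; split => //; last by rewrite i0 => /esym.
    by move: Mk; rewrite i0 x0 yu mdistxx.
  have [i_n|i_n] := eqVneq i n.
    exists v; split => //; last by rewrite i_n => /n0.
    by move: Mk; rewrite i_n xn mdistxx.
  have [iN|nI] := leqP i n; last first.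
    by exists 0; split => // /eqP; rewrite ?(negbTE i0) ?(negbTE i_n).
  have xi : (f @` `[0, n%:R]) (x i).
    by exists i%:R; rewrite ?fx//= in_itv/= ler0n ler_nat.
  have W1 : (1 : R) <= W%:R by rewrite ler1n.
  have ray0 : ray_set gamma (f 0).
    by rewrite (fx 0%N)// x0 yu; exists u => //; rewrite /= in_itv/= u0.
  have rayn : ray_set gamma (f n%:R).
    by rewrite fx// xn; exists v => //; rewrite /= in_itv/= v0.
  have := mP _ _ _ _ _ W1 (ler0n _ 5) (ler0n _ n) fq ray0 rayn _ xi.
  move=> /(@set_dist_ltP _ _ _ _ _ (M * kappa (mdist (gamma 0) (x i)))).
  case; first by rewrite /M mulrDl mul1r ltrDl; lra.
  move=> _ [r /= r0 <-] xr; exists r; split.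
  - by move: r0; rewrite in_itv/= andbT.
  - by move=> _; exact: ltW.
  - by move/eqP; rewrite (negbTE i0).
  - by move/eqP; rewrite (negbTE i_n).
have [tau0 taun] : tau 0%N = u /\ tau n = v.
  by have [_ _ h _] := tauP 0%N; have [_ _ _ h'] := tauP n; rewrite h// h'.
have [||| i [j [/andP[ij jn] ti tj tj1 tr]]] :=
  @crossing_indices _ tau lo hi n.
- by rewrite tau0 /lo /L; lra.
- by rewrite /lo /hi /L; lra.
- by rewrite taun /hi /L; lra.
have Wij : (W * (j - i.+1) <= N)%N.
  apply: xW; first by rewrite ij.
  move=> r irj; rewrite /w asboolT//; exists (tau r); first exact: tr.
  have [_ h _ _] := tauP r; apply: le_trans (h _) _.
    by case/andP: irj => _ /ltnW /leq_trans; apply.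
  apply: ler_wpM2r => //; apply: le_trans ler01 _.
  by apply: (sublin_ge1 kS); exact: mdist_ge0.
pose K k := kappa (mdist (gamma 0) (x k)).
have K1 k : 1 <= K k by apply: (sublin_ge1 kS); exact: mdist_ge0.
have i_n : (i <= n)%N by exact: leq_trans (ltnW ij) jn.
have j1n : (j.-1 <= n)%N by exact: leq_trans (leq_pred j) jn.
have j_gt0 : (0 < j)%N by exact: leq_ltn_trans ij.
have Kle k : (k <= n)%N -> tau k <= v -> K k <= A * kappa v.
  move=> kn kv'; have [k0 kd _ _] := tauP k.
  have h : K k <= A * kappa (tau k).
    apply: AP => //; first exact: mdist_ge0.
    have := metric_triangle (gamma 0) (gamma (tau k)) (x k).
    rewrite ray_norm// (metric_sym (gamma (tau k))) => ?.
    have := sublin_ge1 kS k0; have := kd kn; rewrite -/(K k) => ? ?.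
    have Mt : 0 <= M * kappa (tau k) by apply: mulr_ge0; lra.
    by rewrite mulrDr; lra.
  by have := sublin_homo kS k0 kv' => ?; nra.
have Ki : K i <= A * kappa v.
  by apply: Kle => //; move: ti; rewrite /lo /L; lra.
(* [tau j] may exceed [v], so [x j] is compared with its predecessor, at distance at most 1. *)
have Kj : K j <= (A + kappa 1) * kappa v.
  have h : K j.-1 <= A * kappa v.
    by apply: Kle => //; move: tj1; rewrite /hi /L; lra.
  have d1 : mdist (x j.-1) (x j) <= 1.
    rewrite -!fx//; apply: le_trans (fl _ _) _.
    have -> : j%:R = j.-1%:R + 1 :> R by rewrite natr1 prednK.
    by rewrite opprD addrA subrr sub0r normrN normr1.
  have := metric_triangle (gamma 0) (x j.-1) (x j) => ?.
  have : K j <= kappa (mdist (gamma 0) (x j.-1) + 1).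
    by apply: (sublin_homo kS); [exact: mdist_ge0|lra].
  have := sublinD kS (mdist_ge0 (gamma 0) (x j.-1)) ler01.
  by rewrite -/(K j.-1) => ? ?; nra.
(* The shadows of [x i] and [x j] lie on opposite sides of the middle third, so [j - i] steps bridge
   at least [L / 3] up to the shadowing errors. *)
have dij : L / 3 <= (j - i)%:R + M * (K i + K j).
  have [i0 di _ _] := tauP i; have [j0 dj _ _] := tauP j.
  have {}di := di i_n; have {}dj := dj jn.
  have dx : mdist (x i) (x j) <= (j - i)%:R.
    rewrite -!fx//; apply: le_trans (fl _ _) _.
    by rewrite distrC -natrB ?normr_nat// ltnW.
  have := metric_triangle (gamma (tau i)) (x i) (gamma (tau j)).
  have := metric_triangle (x i) (x j) (gamma (tau j)).
  rewrite ray_dist// (metric_sym (gamma (tau i))) => ? ?.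
  have := ler_norm (tau j - tau i); rewrite distrC => ?.
  by move: ti tj di dj; rewrite /lo /hi /L -/(K i) -/(K j) => *; lra.
have LF : L <= F * kappa v.
  have EK : M * (K i + K j) <= E * kappa v by rewrite /E -mulrA ler_wpM2l; nra.
  have {}Wij : W%:R * ((j - i)%:R - 1) <= C * L + 2.
    apply: le_trans NC; apply: le_trans (_ : (W * (j - i.+1))%:R <= _).
      have -> : (j - i = (j - i.+1).+1)%N by rewrite subnSK.
      by rewrite natrM -natr1 addrK.
    by rewrite ler_nat.
  have W1 : (1 : R) <= W%:R by rewrite ler1n.
  have L0 : 0 <= L by rewrite /L; lra.
  have CL : 12 * (C * L) <= W%:R * L by rewrite mulrA ler_wpM2r.
  have WL : W%:R * (L / 3 - E * kappa v - 1) <= W%:R * ((j - i)%:R - 1).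
    by rewrite ler_wpM2l//; lra.
  have {}WL : W%:R * (L / 4 - E * kappa v - 3) <= W%:R * 0 by lra.
  rewrite ler_pM2l in WL; last by lra.
  by rewrite /F; nra.
have kvu : kappa v <= G * kappa u.
  by apply: GP => //; move: LF; rewrite /L; nra.
(* [gamma lo] is at distance [L / 3] from [y 0 = gamma u], and [L <= F * G * kappa u]. *)
exfalso; apply: nogood; exists 0%N => //; exists lo.
  by rewrite lexx /lo /hi /L; lra.
rewrite yu ray_norm// ray_dist//; last by rewrite /lo /L; lra.
rewrite /lo opprD addrA subrr sub0r normrN ger0_norm; last by rewrite /L; lra.
have : F * kappa v <= F * (G * kappa u) by rewrite ler_wpM2l.
have : F * G * kappa u <= c * kappa u by rewrite ler_wpM2r; lra.
have : 0 <= L by rewrite /L; lra.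
by move=> ? ? ?; lra.
Qed.

Lemma sublinearly_Morse_recurrent gamma : geodesic_ray gamma ->
  sublinearly_Morse (gamma 0) (ray_set gamma) ->
  middle_third_recurrent (gamma 0) gamma.
Proof.
move=> gr [kappa kS kM]; exists kappa => // C C1.
have [c c0 cP] := Morse_coarse_middle gr kS kM C1.
exists c => // s t p st [_ [pc _ _]] [u + pu] [v + pv] plen.
rewrite /= !in_itv/= !andbT => u0 v0.
have [N [y [y0 yN ystep yp NL]]] := coarse_chain st pc plen.
rewrite -pu -pv ray_dist// in NL *.
suff [i [r mr xr]] : exists i, exists2 r,
    middle_third gamma (gamma u) (gamma v) (gamma r) &
    mdist (y i) (gamma r) <= c * kappa (mdist (gamma 0) (y i)).
  by exists (y i); split => //; exact: set_dist_le mr xr.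
have [uv|/ltW vu] := leP u v.
  have [||||i [r [_ rI yr]]] := cP u v N y u0 uv.
  - by rewrite y0 pu.
  - by rewrite yN pv.
  - exact: ystep.
  - by move: NL; rewrite distrC ger0_norm// subr_ge0.
  by exists i, r => //; have [] := ray_middle_third gr u0 uv rI.
(* The path may run towards the origin of the ray; its chain is then reversed. *)
have [||||i [r [_ rI yr]]] := cP v u N (fun i => y (N - i)%N) v0 vu.
- by rewrite subn0 yN pv.
- by rewrite subnn y0 pu.
- move=> i iN; rewrite metric_sym -(subnSK iN); apply: ystep.
  by rewrite subnSK// leq_subr.
- by move: NL; rewrite ger0_norm// subr_ge0.
by exists (N - i)%N, r => //; have [] := ray_middle_third gr v0 vu rI.
Qed.

End Ray.

(** * Recurrent rays are Morse *)

(** [P] need not be closed, so [u] is chosen within 1 of the supremum; this is the source of the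
    unit gap. *)
Lemma last_before (R : realType) (P : set R) (s r : R) : s <= r -> P s ->
  exists u, [/\ s <= u, u <= r, P u & forall x, u + 1 <= x -> x <= r -> ~ P x].
Proof.
move=> sr Ps; pose E := P `&` [set x | s <= x <= r].
have Es : E s by split; rewrite //= lexx.
have hE : has_sup E by split; [exists s|exists r => x [_ /andP[]]].
have [u [Pu /andP[su ur]] supu] := sup_adherent ltr01 hE.
exists u; split => // x ux xr Px.
have : E x by split => //=; rewrite xr andbT; lra.
by move=> /(sup_upper_bound hE) => ?; lra.
Qed.

Lemma first_after (R : realType) (P : set R) (r t : R) : r <= t -> P t ->
  exists v, [/\ r <= v, v <= t, P v & forall x, r <= x -> x <= v - 1 -> ~ P x].
Proof.
move=> rt Pt; have [||u [tu ur Pu uP]] :=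
  @last_before R [set x | P (- x)] (- t) (- r).
- by rewrite lerN2.
- by rewrite /= opprK.
exists (- u); split=> //; [lra|lra|].
by move=> x rx xu; have := uP (- x); rewrite /= opprK; apply; lra.
Qed.

Section Recurrent.
Context {R : realType} {X : metricType R} {gamma : R -> X} {kappa : R -> R}.
Hypothesis gammaray : geodesic_ray gamma.
Implicit Types (x y z : X).

(** Points of the ray within 1 of [x] have parameter at most [T], so near [x] the ray is a compact
    arc. The absolute value makes [f] 1-Lipschitz on all of R. *)
Lemma ray_closed : closed (ray_set gamma).
Proof.
pose f (t : R) := gamma `|t|.
have fl : lip1 f by move=> s t; rewrite /f ray_dist// ler_dist_dist.
move=> x clx; pose T := mdist (gamma 0) x + 1.
have : closed (f @` `[0, T]).
  apply: compact_closed; first exact: metric_hausdorff.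
  by apply: continuous_compact_image; exact: lip1_continuous.
have sub : f @` `[0, T] `<=` ray_set gamma.
  by move=> _ [t _ <-]; exists `|t| => //=; rewrite in_itv/= normr_ge0.
move=> /(_ x) fx; apply/sub/fx => B xB.
have : nbhs x (ball x 1 `&` B) by apply: filterI => //; exact: nbhsx_ballx.
move=> /clx[_ [[t /= t0 <-] [xt Bt]]]; exists (gamma t); split=> //.
move: t0; rewrite in_itv/= andbT => t0.
exists t; last by rewrite /f ger0_norm.
rewrite /= in_itv/= t0/=; move: xt; rewrite ballEmdist/= => xt.
have := metric_triangle (gamma 0) x (gamma t).
by rewrite ray_norm// /T => ?; lra.
Qed.

Hypothesis kappaS : sublinear_function kappa.
Hypothesis Xgeodesic : geodesic_space X.
Local Notation kn x := (kappa (mdist (gamma 0) x)).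

Lemma kappa_norm_ge1 x : 1 <= kn x.
Proof. by apply: (sublin_ge1 kappaS); exact: mdist_ge0. Qed.

(** A quasi-geodesic may have infinite length, so only its values at unit time steps are kept and
    joined by geodesics, together with [a] and [b], before loops are erased. Each point of the arc
    is attributed to a join or to the sample starting its piece; sample times other than [u] are at
    least [u + 1], matching the gap in [last_before]. *)
Lemma sampled_arc (h u v : R) (beta : R -> X) (a b : X) : u <= v ->
  (forall x y : R, u <= x <= v -> u <= y <= v -> `|x - y| <= 1 ->
    mdist (beta x) (beta y) <= h) ->
  exists (l : R) p,
    [/\ 0 <= l, lip1 p, {in `[0, l] &, injective p}, p 0 = a & p l = b] /\
    l <= mdist (beta u) a + mdist (beta v) b + h * (v - u + 1) /\
    forall r, r \in `[0, l] ->
      [\/ mdist (p r) a <= mdist (beta u) a,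
          mdist (p r) b <= mdist (beta v) b |
          exists2 x : R, mdist (p r) (beta x) <= h & x = u \/ u + 1 <= x <= v].
Proof.
move=> uv bh; have uv0 : 0 <= v - u by rewrite subr_ge0.
have h0 : 0 <= h.
  by rewrite -(mdistxx (beta u)); apply: bh; rewrite ?lexx// subrr normr0 ler01.
pose N := (Num.truncn (v - u)).+1.
have [uvN Nuv] : v - u <= N%:R /\ N%:R <= v - u + 1.
  by have /andP[? ?] := truncn_itv uv0; rewrite /N -natr1; split; lra.
pose w k : R := Num.min (u + k%:R) v.
have w0 : w 0%N = u by rewrite /w addr0; apply/min_idPl.
have wN : w N = v by rewrite /w; apply/min_idPr; lra.
have wI k : u <= w k <= v by rewrite /w le_min lerDl ler0n uv ge_min lexx orbT.
have wS k : `|w k - w k.+1| <= 1.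
  rewrite /w -natr1 ler_norml.
  case: (leP (u + k%:R) v) => ?; case: (leP (u + (k%:R + 1)) v) => ?;
  by apply/andP; split; lra.
pose y i := if i is k.+1 then if (k <= N)%N then beta (w k) else b else a.
have y_beta k : (k <= N)%N -> y k.+1 = beta (w k) by move=> /= ->.
have y_end : y N.+2 = b by rewrite /= ltnn.
have y_step k : (k < N)%N -> mdist (y k.+1) (y k.+2) <= h.
  by move=> kN; rewrite (y_beta _ (ltnW kN)) (y_beta _ kN); exact: bh.
have [l [p [[l0 pl pinj p0 pe] [lle pP]]]] := chain_arc Xgeodesic y N.+2.
rewrite y_end in pe; have {}p0 : p 0 = a := p0.
exists l, p; split; [by []|split].
  have yN : \sum_(0 <= i < N) mdist (y i.+1) (y i.+2) <= h * (v - u + 1).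
    apply: (@le_trans _ _ (h * N%:R)); last by rewrite ler_wpM2l.
    rewrite mulr_natr -[N in leRHS]subn0 -sumr_const_nat.
    by apply: ler_sum_nat => i /andP[_]; exact: y_step.
  apply: (le_trans lle); rewrite big_nat_recl// big_nat_recr// y_end.
  rewrite (y_beta 0%N)// (y_beta N)// w0 wN (metric_sym (y 0%N)) /=.
  by rewrite -addrA lerD2l addrC lerD2l.
move=> r rI; have [pa|[[_|k]]] := pP _ rI.
- by apply: Or31; rewrite pa mdistxx mdist_ge0.
- have -> : y 1%N = beta u by rewrite (y_beta 0%N)// w0.
  move=> pau; apply: Or31.
  by rewrite (metric_sym (p r)) (metric_sym (beta u)) -pau lerDl mdist_ge0.
rewrite ltnS leq_eqVlt => /orP[/eqP-> pk|]; last rewrite ltnS => kN pk.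
  apply: Or32; move: pk; rewrite y_end (y_beta N)// wN => <-.
  by rewrite lerDr mdist_ge0.
apply: Or33; exists (w k).
  apply: le_trans (y_step k kN).
  by rewrite -pk (y_beta _ (ltnW kN)) metric_sym lerDl mdist_ge0.
have [->|k0] := eqVneq k 0%N; first by left.
right; have := wI k; rewrite /w => /andP[_ ->]; rewrite andbT le_min.
have k1 : 1 <= k%:R :> R by rewrite ler1n lt0n.
have kuv : k%:R <= v - u.
  have /andP[+ _] := truncn_itv uv0; apply: le_trans.
  by rewrite ler_nat -ltnS.
by apply/andP; split; lra.
Qed.

(** A middle third point [z] is at least [D / 3] from [e'], yet it is reached from [e'] through [x];
    [sublin_comparable] replaces [kn x] by [kn e]. The [2 * h] allows one step from an arc point to
    a sample and one from that sample to the end. *)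
Lemma middle_third_near_end (h K c : R) : 0 <= h -> 0 <= K -> 0 <= c ->
  exists2 M, 0 <= M & forall (e e' x z : X) (D : R),
    mdist e e' <= K * kn e -> mdist x e' <= 2 * h + K * kn e ->
    mdist x z <= c * kn x -> 3^-1 * D <= mdist z e' -> D <= M * kn e.
Proof.
move=> h0 K0 c0.
have [A A1 AP] := @sublin_comparable _ _ kappaS (2 * h + 2 * K) ltac:(lra).
exists (3 * (2 * h + K + c * A)) => [|e e' x z D ee' xe' xz zD].
  by have : 0 <= c * A by [apply: mulr_ge0; lra]; lra.
have ke := kappa_norm_ge1 e; have kx := kappa_norm_ge1 x.
have he : 2 * h <= 2 * h * kn e by rewrite ler_peMr//; lra.
have xA : kn x <= A * kn e.
  apply: AP; rewrite ?mdist_ge0//.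
  have := metric_triangle (gamma 0) e x.
  have := metric_triangle e e' x; rewrite (metric_sym e' x).
  have : 0 <= (2 * h + 2 * K) * kn x by apply: mulr_ge0; lra.
  by move=> ? ? ?; lra.
have := metric_triangle z x e'; rewrite (metric_sym z x) => ?.
have xcA : c * kn x <= c * (A * kn e) by rewrite ler_wpM2l.
lra.
Qed.

(** The bound on [mdist y x] has the form a quasi-geodesic provides: its lower inequality limits the
    time from [y] to [y'], its upper one turns time into displacement. Weights pass from [y'] to
    [y], then from [y] to [x], by [sublin_comparable]. *)
Lemma excursion_near_ray (q Q K M : R) : 1 <= q -> 0 <= Q -> 0 <= K -> 0 <= M ->
  exists2 M', 0 <= M' & forall y y' x a a' : X,
    mdist y a <= K * kn y -> mdist y' a' <= K * kn y' ->
    mdist a a' <= M * (kn y + kn y') ->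
    mdist y x <= q * (q * (mdist y y' + Q)) + Q ->
    mdist x a <= M' * kn x.
Proof.
move=> q1 Q0 K0 M0; have q0 : 0 <= q by lra.
have [B B1 BP] := @sublin_comparable _ _ kappaS (M + K) ltac:(lra).
pose P := q * (q * (M + K + Q)) + Q.
have P0 : 0 <= P.
  by rewrite /P; apply: addr_ge0 => //; do 2!apply: mulr_ge0 => //; lra.
pose S := P * (1 + B).
have S0 : 0 <= S by apply: mulr_ge0 => //; lra.
have [B' B'1 B'P] := @sublin_comparable _ _ kappaS S S0.
exists ((S + K) * B') => [|y y' x a a' ya ya' aa' yx].
  by apply: mulr_ge0; lra.
have ky := kappa_norm_ge1 y; have ky' := kappa_norm_ge1 y'.
have kx := kappa_norm_ge1 x.
have yy' : mdist y y' <= (M + K) * (kn y + kn y').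
  have := metric_triangle y a y'; have := metric_triangle a a' y'.
  by rewrite (metric_sym a' y') => ? ?; lra.
have k'k : kn y' <= B * kn y.
  apply: BP; rewrite ?mdist_ge0//.
  by have := metric_triangle (gamma 0) y y' => ?; lra.
have yxS : mdist y x <= S * kn y.
  have sum1 : Q <= Q * (kn y + kn y') by rewrite ler_peMr//; lra.
  apply: (le_trans yx); apply: (@le_trans _ _ (P * (kn y + kn y'))).
    rewrite /P mulrDl lerD// -!mulrA !ler_wpM2l//.
    lra.
  by rewrite /S -mulrA ler_wpM2l//; lra.
have kyx : kn y <= B' * kn x.
  apply: B'P; rewrite ?mdist_ge0//.
  have := metric_triangle (gamma 0) x y; rewrite (metric_sym x y) => ?.
  have : 0 <= S * kn x by apply: mulr_ge0; lra.
  by move=> ?; lra.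
have := metric_triangle x y a; rewrite (metric_sym x y) => ?.
apply: (@le_trans _ _ ((S + K) * kn y)); first lra.
by rewrite -mulrA ler_wpM2l//; lra.
Qed.

(** Once [a] and [b] are far apart, the sampled arc has length at most [C * mdist a b], the 1 in [C]
    paying for the joins and the other term for the samples. It therefore meets a neighbourhood of
    the middle third; the hypothesis on times in [[u + 1, v - 1]] leaves only its ends, where
    [middle_third_near_end] applies. *)
Lemma excursion_span (q Q K c : R) : 1 <= q -> 0 <= Q -> 0 <= K -> 0 <= c ->
  let C := 1 + (q + Q) * (2 * q + q * Q + 1) in
  exists2 M, 0 <= M & forall (u v : R) (beta : R -> X) (a b : X),
    u <= v -> quasi_geodesic q Q u v beta ->
    ray_set gamma a -> ray_set gamma b ->
    mdist (beta u) a <= K * kn (beta u) ->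
    mdist (beta v) b <= K * kn (beta v) ->
    (forall x : R, u + 1 <= x -> x <= v - 1 -> forall y z, ray_set gamma z ->
      mdist y (beta x) <= q + Q -> ~ mdist y z <= (c + 1) * kn y) ->
    (forall (s t : R) (p : R -> X),
      s <= t -> @embedding_on R X `[s, t] p ->
      ray_set gamma (p s) -> ray_set gamma (p t) ->
      (arc_length s t p <= (C * mdist (p s) (p t))%:E)%E ->
      p @` `[s, t] `&`
        kappa_nbhd (gamma 0) kappa (middle_third gamma (p s) (p t)) c !=set0) ->
    mdist a b <= M * (kn (beta u) + kn (beta v)).
Proof.
move=> q1 Q0 K0 c0 C; have q0 : 0 <= q by lra.
have qQ0 : 0 <= q + Q by lra.
have [M0 M00 M0P] := @middle_third_near_end (q + Q) K (c + 1) qQ0 K0 ltac:(lra).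
exists (K + 1 + M0) => [|u v beta a b uv [_ bq] ra rb ua vb bad cP]; first lra.
have ku := kappa_norm_ge1 (beta u); have kv := kappa_norm_ge1 (beta v).
(* In the second case [mdist a b] exceeds 1 and both joins together, so additive constants are
   absorbed into multiples of it. *)
have [small|big] := leP (mdist a b) (K * (kn (beta u) + kn (beta v)) + 1).
  have : 0 <= M0 * (kn (beta u) + kn (beta v)) by apply: mulr_ge0; lra.
  by move=> ?; lra.
have lenM (e D : R) : kn (beta e) <= kn (beta u) + kn (beta v) ->
    D <= M0 * kn (beta e) -> D <= (K + 1 + M0) * (kn (beta u) + kn (beta v)).
  move=> eS /le_trans; apply.
  by apply: ler_pM; rewrite ?M00//; have := kappa_norm_ge1 (beta e); lra.
have bh (x y : R) : u <= x <= v -> u <= y <= v -> `|x - y| <= 1 ->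
    mdist (beta x) (beta y) <= q + Q.
  move=> xI yI xy; have /andP[_] := bq x y xI yI.
  by move/le_trans; apply; rewrite lerD2r ler_piMr.
have [l [p [[l0 pl pinj p0 pe] [lle pP]]]] := sampled_arc a b uv bh.
have uvq : v - u <= q * (mdist (beta u) (beta v) + Q).
  have /andP[+ _] := bq u v ltac:(by rewrite in_itv/= lexx)
    ltac:(by rewrite in_itv/= lexx andbT).
  rewrite lerBlDr ler_pdivrMl; last by lra.
  by rewrite distrC ger0_norm ?subr_ge0.
have lC : l <= C * mdist a b.
  have b1 : Q <= Q * mdist a b.
    rewrite ler_peMr//; have : 0 <= K * (kn (beta u) + kn (beta v)).
      by apply: mulr_ge0; lra.
    by move=> ?; lra.
  have buv : mdist (beta u) (beta v) <= 2 * mdist a b.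
    have := metric_triangle (beta u) a (beta v).
    have := metric_triangle a b (beta v).
    by rewrite (metric_sym b (beta v)) => ? ?; lra.
  have vuq : v - u <= q * (2 * mdist a b + Q * mdist a b).
    by apply: (le_trans uvq); rewrite ler_wpM2l//; lra.
  have : 0 <= K * (kn (beta u) + kn (beta v)) by apply: mulr_ge0; lra.
  have : (q + Q) * (v - u + 1) <=
      (q + Q) * (q * (2 * mdist a b + Q * mdist a b) + mdist a b).
    rewrite ler_wpM2l// lerD//; have : 0 <= K * (kn (beta u) + kn (beta v)).
      by apply: mulr_ge0; lra.
    by move=> ?; lra.
  by move=> ? ?; rewrite /C; lra.
have [||||_ [[r /= rI <-]]] := cP 0 l p l0.
- exact: lip1_embedding.
- by rewrite p0.
- by rewrite pe.
- rewrite p0 pe; apply: le_trans (lip1_arc_length _ _ pl) _.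
  by rewrite lee_fin subr0.
rewrite p0 pe => /(@set_dist_ltP _ _ _ _ _ ((c + 1) * kn (p r)))[].
  by rewrite mulrDl mul1r ltrDl (lt_le_trans ltr01)// kappa_norm_ge1.
move=> z [[z1 [z2 [z3 [[z10 z20 z1a z2b] [/andP[z13 _] zE]]]]]].
rewrite le_min => /andP[za zb] /ltW pz.
have rz : ray_set gamma z.
  by exists z3 => //=; rewrite in_itv/= andbT (le_trans _ z13)// le_min z10.
have near_u : mdist (p r) a <= 2 * (q + Q) + K * kn (beta u) ->
    mdist a b <= (K + 1 + M0) * (kn (beta u) + kn (beta v)).
  by move=> pa; apply: (lenM u); [lra|exact: M0P ua pa pz za].
have near_v : mdist (p r) b <= 2 * (q + Q) + K * kn (beta v) ->
    mdist a b <= (K + 1 + M0) * (kn (beta u) + kn (beta v)).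
  by move=> pb; apply: (lenM v); [lra|exact: M0P vb pb pz zb].
have [pa|pb|[x px xP]] := pP r rI.
- by apply: near_u; lra.
- by apply: near_v; lra.
case: xP px => [->|/andP[ux xv]] px.
  by apply: near_u; have := metric_triangle (p r) (beta u) a => ?; lra.
(* Samples later than [v - 1] escape [bad] but lie one unit step from [beta v]. *)
have [xv1|vx] := leP x (v - 1); first by have := bad x ux xv1 _ z rz px.
apply: near_v; have xvh : mdist (beta x) (beta v) <= q + Q.
  apply: bh; [|by rewrite uv lexx|by rewrite distrC ger0_norm; lra].
  by rewrite xv andbT; lra.
have := metric_triangle (p r) (beta x) (beta v).
have := metric_triangle (p r) (beta v) b => ? ?.
lra.
Qed.

Lemma recurrent_quasi_geodesic (q Q c : R) : 1 <= q -> 0 <= Q -> 0 <= c ->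
  (forall (s t : R) (p : R -> X),
    s <= t -> @embedding_on R X `[s, t] p ->
    ray_set gamma (p s) -> ray_set gamma (p t) ->
    (arc_length s t p <= ((1 + (q + Q) * (2 * q + q * Q + 1)) *
      mdist (p s) (p t))%:E)%E ->
    p @` `[s, t] `&`
      kappa_nbhd (gamma 0) kappa (middle_third gamma (p s) (p t)) c !=set0) ->
  exists2 M, 0 <= M & forall (s t : R) (beta : R -> X),
    s <= t -> quasi_geodesic q Q s t beta ->
    ray_set gamma (beta s) -> ray_set gamma (beta t) ->
    forall r, r \in `[s, t] ->
      exists2 z, ray_set gamma z & mdist (beta r) z <= M * kn (beta r).
Proof.
move=> q1 Q0 c0 cP; set h := q + Q.
have h0 : 0 <= h by rewrite /h; lra.
have kh := sublin_ge1 kappaS h0.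
(* With this [K], a time [x] is good as soon as some point within [h] of [beta x] is within
   [(c + 1) * kappa] of the ray. *)
pose K := h + (c + 1) * (1 + kappa h).
have K0 : 0 <= K by rewrite /K; apply: addr_ge0 => //; apply: mulr_ge0; lra.
have [M M0 MP] := excursion_span q1 Q0 K0 c0.
have [M' M'0 M'P] := excursion_near_ray q1 Q0 K0 M0.
exists M' => // s t beta st [bc bq] rs rt r rI.
pose good (x : R) := exists2 z, ray_set gamma z &
  mdist (beta x) z <= K * kn (beta x).
have good_ray (x : R) : ray_set gamma (beta x) -> good x.
  move=> rx; exists (beta x); rewrite // mdistxx; apply: mulr_ge0 => //.
  exact: le_trans (kappa_norm_ge1 _).
move: (rI); rewrite in_itv/= => /andP[sr rt'].
(* The excursion around [r] lies between almost the last good time before [r] and almost the first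
   one after it; both exist because [beta] has its ends on the ray. *)
have [u [su ur [a ra ua] ubad]] := last_before sr (good_ray _ rs).
have [v [rv vt [b rb vb] vbad]] := first_after rt' (good_ray _ rt).
have uv : u <= v := le_trans ur rv.
have stI (x : R) : x \in `[u, v] -> x \in `[s, t].
  by rewrite !in_itv/= => /andP[ux xv]; rewrite (le_trans su)//= (le_trans xv).
have uI : u \in `[s, t] by apply: stI; rewrite in_itv/= lexx.
have vI : v \in `[s, t] by apply: stI; rewrite in_itv/= lexx andbT.
exists a => //; apply: (M'P _ _ _ _ _ ua vb).
  apply: (MP _ _ _ _ _ uv) => //.
    split=> [|x y xI yI]; last by apply: bq; apply: stI.
    by apply: continuous_subspaceW bc => x; exact: stI.
  move=> x ux xv y z rz yx yz.
  have : good x.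
    exists z => //; have := metric_triangle (beta x) y z.
    have := metric_triangle (gamma 0) (beta x) y.
    rewrite (metric_sym (beta x) y) => n1 n2.
    have ky : kn y <= (1 + kappa h) * kn (beta x).
      apply: le_trans (sublinDM kappaS _ h0); rewrite ?mdist_ge0//.
      by apply: (sublin_homo kappaS); [exact: mdist_ge0|rewrite /h; lra].
    have : (c + 1) * kn y <= (c + 1) * ((1 + kappa h) * kn (beta x)).
      by rewrite ler_wpM2l//; lra.
    have : h <= h * kn (beta x) by rewrite ler_peMr// kappa_norm_ge1.
    by move=> ? ?; rewrite /K mulrDl -mulrA; rewrite -/h in yx; lra.
  have [xr|/ltW rx] := leP x r; first exact: ubad.
  exact: vbad.
have /andP[_] := bq _ _ uI rI.
rewrite distrC ger0_norm ?subr_ge0// => /le_trans; apply.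
rewrite lerD2r ler_wpM2l//; first by lra.
apply: (@le_trans _ _ (v - u)); first by lra.
have /andP[+ _] := bq _ _ uI vI.
rewrite lerBlDr ler_pdivrMl; last by lra.
by rewrite distrC ger0_norm ?subr_ge0.
Qed.

End Recurrent.

Lemma recurrent_sublinearly_Morse (R : realType) (X : metricType R)
    (gamma : R -> X) : geodesic_space X -> geodesic_ray gamma ->
  middle_third_recurrent (gamma 0) gamma ->
  sublinearly_Morse (gamma 0) (ray_set gamma).
Proof.
move=> Xgeodesic gr [kappa kS rP]; exists kappa => //.
split; first exact: ray_closed.
have /choice[m mP] (qQ : R * R) : exists M, 0 <= M /\
    (1 <= qQ.1 -> 0 <= qQ.2 -> forall (s t : R) (beta : R -> X),
      s <= t -> quasi_geodesic qQ.1 qQ.2 s t beta ->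
      ray_set gamma (beta s) -> ray_set gamma (beta t) ->
      forall r, r \in `[s, t] -> exists2 z, ray_set gamma z &
        mdist (beta r) z <= M * kappa (mdist (gamma 0) (beta r))).
  case: qQ => q Q /=.
  (* The gauge must be nonnegative for all arguments; inadmissible pairs get the default 0. *)
  have [[q1 Q0]|qQ] := pselect (1 <= q /\ 0 <= Q); last first.
    by exists 0; split=> // q1 Q0; case: qQ.
  have C1 : 1 <= 1 + (q + Q) * (2 * q + q * Q + 1).
    by rewrite lerDl; do ?[apply: addr_ge0|apply: mulr_ge0]; lra.
  have [c c0 cP] := rP _ C1.
  have [M M0 MP] :=
    recurrent_quasi_geodesic kS Xgeodesic q1 Q0 c0 cP.
  by exists M; split.
exists (fun q Q => m (q, Q)); split=> [q Q _ _|q Q s t beta q1 Q0 st bQ rs rt].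
  by have [] := mP (q, Q).
move=> _ [r rI <-]; have [_ /(_ q1 Q0 _ _ _ st bQ rs rt _ rI)] := mP (q, Q).
by move=> [z rz rzd]; exact: set_dist_le rzd.
Qed.

Theorem theorem2 (R : realType) (X : metricType R) (o : X) (gamma : R -> X)
  (Xproper : proper_space X) (Xgeodesic : geodesic_space X)
  (gammaray : geodesic_ray gamma) (gamma0 : gamma 0 = o) :
  sublinearly_Morse o (ray_set gamma) <-> middle_third_recurrent o gamma.
Proof.
rewrite -gamma0; split.
- exact: sublinearly_Morse_recurrent.
- exact: recurrent_sublinearly_Morse.
Qed.
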